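(* Let $\mathfrak{g}$ be a $2n$-dimensional real Lie algebra with an almost complex structure $J$, i.e. a real linear endomorphism of $\mathfrak{g}$ with $J^2=-I$. Let $\sigma\in\bigwedge^{n,0}\mathfrak{g}^*$ be a nonzero $(n,0)$-form on $\mathfrak{g}$ (with respect to $J$). Then $d\sigma=0$ if and only if $J$ is integrable and $\psi\equiv 0$, where $\psi\in\mathfrak{g}^*$ is the Koszul $1$-form of $(\mathfrak{g},J)$.
   Context: For a real Lie algebra $\mathfrak{g}$ with an endomorphism $J$ satisfying $J^2=-I$, the Koszul $1$-form $\psi\in\mathfrak{g}^*$ is defined by $\psi(x)=\operatorname{Tr}(J\operatorname{ad}x)-\operatorname{Tr}\operatorname{ad}(Jx)$, $x\in\mathfrak{g}$. $J$ is integrable if $N_J(x,y)=[x,y]+J([Jx,y]+[x,Jy])-[Jx,Jy]$ vanishes for all $x,y\in\mathfrak{g}$. A complex-valued linear form $\gamma$ on $\mathfrak{g}$ is of type $(1,0)$ if $\gamma(Jx)=i\gamma(x)$ for all $x\in\mathfrak{g}$; $\bigwedge^{n,0}\mathfrak{g}^*$ is the (complex one-dimensional) $n$-th exterior power of the space of $(1,0)$-forms. The differential $d$ is the Chevalley–Eilenberg differential, extended $\mathbb{C}$-linearly ($d\gamma(x,y)=-\gamma([x,y])$ on $1$-forms). *)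

(* Defs.v *)
From HB Require Import structures.
From mathcomp Require Import all_boot all_order all_algebra.
From mathcomp Require Import reals complex.

Set Implicit Arguments.
Unset Strict Implicit.
Unset Printing Implicit Defensive.

Import GRing.Theory.
Local Open Scope ring_scope.

HB.mixin Record isLieAlgebra (R : fieldType) g of Vector R g := {
  lie : g -> g -> g;
  lie_linearl : forall y, linear (lie^~ y);
  lie_linearr : forall x, linear (lie x);
  liexx : forall x, lie x x = 0;
  lie_jacobi : forall x y z,
    lie x (lie y z) + lie y (lie z x) + lie z (lie x y) = 0
}.

#[short(type="lieAlgType")]
HB.structure Definition LieAlgebra (R : fieldType) :=
  { g of isLieAlgebra R g & Vector R g }.

Section KoszulForm.
Variables (R : fieldType) (g : lieAlgType R).
Implicit Types (x y : g) (f J : 'End(g)).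

Definition ad x : 'End(g) := linfun (lie x).

Definition lftrace f : R := \tr (passmx.mxof (vbasis fullv) (vbasis fullv) f).

Definition almost_complex J : Prop := (J \o J)%VF = - \1%VF.

Definition nijenhuis J x y : g :=
  lie x y + J (lie (J x) y + lie x (J y)) - lie (J x) (J y).

Definition integrable J : Prop := forall x y, nijenhuis J x y = 0.

Definition koszul J x : R := lftrace (J \o ad x)%VF - lftrace (ad (J x)).

End KoszulForm.

Section Forms.
Variables (R : realType) (g : lieAlgType R).

(* Complex-valued k-forms are represented by their values on k-tuples. *)
Definition cform k := ('I_k -> g) -> R[i].

(* Rcomplex R is R[i] viewed as a real vector space, so a complex-valued       *)
(* linear form on the real Lie algebra g is a {linear g -> Rcomplex R}.        *)
Definition is_form10 (J : 'End(g)) (gamma : {linear g -> Rcomplex R}) : Prop :=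
  forall x, (gamma (J x) : R[i]) = 'i%C * gamma x.

Definition wedge n (gamma : 'I_n -> {linear g -> Rcomplex R}) : cform n :=
  fun x => \det (\matrix_(i < n, j < n) (gamma i (x j) : R[i])).

(* The n-th exterior power of the space of (1,0)-forms, inside the alternating *)
(* forms: the complex span of the wedge products of n forms of type (1,0).     *)
Definition is_formn0 (J : 'End(g)) n (sigma : cform n) : Prop :=
  exists (m : nat) (c : 'I_m -> R[i])
         (gamma : 'I_m -> 'I_n -> {linear g -> Rcomplex R}),
    (forall k i, is_form10 J (gamma k i)) /\
    (forall x, sigma x = \sum_(k < m) c k * wedge (gamma k) x).

(* For i < j, the n-tuple ([x_i, x_j], x_0, .., x_n with x_i and x_j omitted): *)
(* m |-> bump j (bump i m) enumerates increasingly the indices other than i, j. *)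
Definition ce_args n (x : 'I_n.+1 -> g) (i j : 'I_n.+1) : 'I_n -> g :=
  fun k => if (k : nat) is m.+1 then x (inord (bump j (bump i m)))
           else lie (x i) (x j).

(* Chevalley-Eilenberg differential; on 1-forms, d gamma(x, y) = -gamma([x,y]). *)
Definition ce_d n (sigma : cform n) : cform n.+1 :=
  fun x => \sum_(i < n.+1) \sum_(j < n.+1 | (i < j)%N)
             (-1) ^+ (i + j) * sigma (ce_args x i j).

End Forms.

(* Main.v *)
(* With the determinant of the coordinates in a complex basis of (g, J)        *)
(* written vol, sigma is a nonzero multiple of vol. Put A_v = ad v + J ad (Jv).*)
(* Inserting the (0,1)-vector v + iJv in slot k of d vol leaves only the       *)
(* brackets with it, because vol kills (0,1)-vectors, and what remains is, up  *)
(* to sign, the derivation sum_m vol(z_1, .., A_v z_m, .., z_n).               *)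
(* Replacing z_m by J z_m in this sum isolates vol(.., [A_v, J] z_m, ..), and  *)
(* J N_J(v, u) = [J, A_v] u, so the vanishing of all these sums forces N_J = 0.*)
(* When N_J = 0 the operator A_v is complex linear, the sum equals             *)
(* tr_C(A_v) vol(z), and 2 tr_C(A_v) = psi(Jv) - i psi(v).                     *)
(* Conversely, if all these sums vanish then d vol is complex multilinear and  *)
(* alternating in n + 1 arguments of an n-dimensional space, hence zero.       *)
Require Import Defs.
From HB Require Import structures.
From mathcomp Require Import all_boot all_order all_algebra.
From mathcomp Require Import reals complex.
From mathcomp Require Import ring zify.

Set Implicit Arguments.
Unset Strict Implicit.
Unset Printing Implicit Defensive.

Import GRing.Theory.
Local Open Scope ring_scope.

(** A point [x0] where sigma does not vanish is itself a complex basis of (g, J): [exists_frame]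
    provides its coordinates [phi], and [formn0_vol] gives sigma = sigma(x0) vol. So everything
    reduces to d vol, settled in [dvol_eq0P]. The failure of d vol to be complex linear in a slot is
    [derivation v], obtained by inserting v + iJv ([dvol_updJ]); if it vanishes for all v, so does d
    vol, for reasons of dimension ([dvol_Jlinear_eq0]). In turn [derivation v] vanishes exactly when
    [adJ v] commutes with J ([derivation_updJ]), which for all v is integrability ([integrableP]),
    and has complex trace zero ([derivation_trace]). The real and imaginary parts of that trace are
    psi(Jv)/2 and -psi(v)/2 ([koszul_ctrace]). *)

Section Replace.
Variables (T : Type) (n : nat).
Implicit Types (x : 'I_n -> T) (k l : 'I_n) (v w : T).

Definition upd x k v : 'I_n -> T := fun l => if l == k then v else x l.

Lemma upd_at x k v : upd x k v k = v.
Proof. by rewrite /upd eqxx. Qed.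

Lemma upd_off x k v l : l != k -> upd x k v l = x l.
Proof. by rewrite /upd => /negbTE->. Qed.

Lemma upd_id x k : upd x k (x k) =1 x.
Proof. by move=> l; rewrite /upd; case: eqP => // ->. Qed.

End Replace.

Lemma upd_lift_neq (T : Type) n (x : 'I_n -> T) k v (m : 'I_n.-1) :
  upd x k v (lift k m) = x (lift k m).
Proof. by rewrite upd_off // eq_sym neq_lift. Qed.

Lemma upd_lift (T : Type) n (x : 'I_n.+1 -> T) k m v :
  (fun j => upd x (lift k m) v (lift k j)) =1 upd (fun j => x (lift k j)) m v.
Proof. by move=> j; rewrite /upd (inj_eq lift_inj). Qed.

Lemma sum_neq_lift (V : nmodType) n (k : 'I_n.+1) (F : 'I_n.+1 -> V) :
  \sum_(l | l != k) F l = \sum_m F (lift k m).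
Proof.
rewrite (reindex_omap (lift k) (unlift k)) /=; last first.
  by move=> i ik; case: unliftP ik => [j ->|->]; rewrite ?eqxx.
by apply: eq_bigl => j; rewrite eq_sym neq_lift liftK eqxx.
Qed.

(** * Determinant identities and linear dependence of rows *)

Section Determinants.
Variable R : comNzRingType.

Lemma det_row_to_top n (A B : 'M[R]_n.+1) p :
    A 0 =1 B p -> (forall m, A (lift 0 m) =1 B (lift p m)) ->
  \det A = (-1) ^+ p * \det B.
Proof.
move=> A0 A'; rewrite (expand_det_row A 0) (expand_det_row B p) mulr_sumr.
apply: eq_bigr => j _; rewrite A0 /cofactor add0n exprD.
have -> : row' 0 (col' j A) = row' p (col' j B).
  by apply/matrixP => m b; rewrite !mxE A'.
by rewrite [RHS]mulrCA; congr (_ * _); rewrite !mulrA -expr2 sqrr_sign mul1r.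
Qed.

(* Cofactor expansion along the first column of the square matrix obtained by  *)
(* prepending to the rows y the indicator of {k, l}: its rows k and l agree.   *)
Lemma signed_minors_eq_rows n (y : 'I_n.+1 -> 'rV[R]_n) k l :
    k != l -> y k = y l ->
  (-1) ^+ k * \det (\matrix_m y (lift k m))
  = - ((-1) ^+ l * \det (\matrix_m y (lift l m))).
Proof.
move=> kl ykl; apply/eqP; rewrite -addr_eq0; apply/eqP.
pose B : 'M[R]_n.+1 := \matrix_(i, j)
  if unlift 0 j is Some b then y i 0 b else ((i == k) || (i == l))%:R.
have -> : 0 = \det B.
  symmetry; apply: (determinant_alternate kl) => j.
  by rewrite !mxE ykl !eqxx orbT.
have Bminor i : B i 0 * cofactor B i 0
    = ((i == k) || (i == l))%:R * ((-1) ^+ i * \det (\matrix_m y (lift i m))).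
  rewrite /cofactor mxE unlift_none addn0.
  have -> // : row' i (col' 0 B) = \matrix_m y (lift i m).
  by apply/matrixP => a b; rewrite !mxE liftK.
rewrite (expand_det_col _ 0) (eq_bigr _ (fun i _ => Bminor i)).
rewrite (bigD1 k) //= (bigD1 l) 1?eq_sym //= big1 ?addr0.
  by rewrite !eqxx orbT !mul1r.
by move=> i /andP[/negbTE-> /negbTE->]; rewrite mul0r.
Qed.

(** Expanding the m-th determinant along its row m gives the m-th diagonal entry of
    [Z *m B *m \adj Z]; cyclicity of the trace then brings [\adj Z] next to [Z]. *)
Lemma sum_det_upd_row n (Z B : 'M[R]_n) :
  \sum_m \det (\matrix_i upd (fun k => row k Z) m (row m (Z *m B)) i)
  = \tr B * \det Z.
Proof.
transitivity (\tr (Z *m B *m \adj Z)).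
  apply: eq_bigr => m _; rewrite (expand_det_row _ m) [RHS]mxE.
  apply: eq_bigr => j _; rewrite !mxE upd_at mxE.
  rewrite mxE.
  congr (_ * (_ * \det _)).
  by apply/matrixP => a b; rewrite !mxE upd_lift_neq mxE.
rewrite -mulmxA mxtrace_mulC -mulmxA mul_adj_mx mul_mx_scalar mxtraceZ mulrC.
by [].
Qed.

End Determinants.

Lemma lin_dep_rows (F : fieldType) n (y : 'I_n.+1 -> 'rV[F]_n) :
  exists c : 'I_n.+1 -> F, (exists l, c l != 0) /\ \sum_k c k *: y k = 0.
Proof.
have : kermx (\matrix_k y k) != 0.
  rewrite kermx_eq0 /row_free; apply: contraTneq (rank_leq_col (\matrix_k y k)).
  by move->; rewrite ltnn.
case/rowV0Pn=> c /sub_kermxP c0 cN0; exists (c 0); split.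
  apply/existsP; rewrite -negb_forall; apply: contra cN0 => /forallP c0'.
  by apply/eqP/rowP => j; rewrite mxE; apply/eqP.
by rewrite -[RHS]c0 mulmx_sum_row; apply: eq_bigr => k _; rewrite rowK.
Qed.

(** * Brackets and traces on a Lie algebra *)

HB.instance Definition _ (R : fieldType) (g : lieAlgType R) (x : g) :=
  GRing.isLinear.Build R g g *:%R (lie x) (lie_linearr x).

Lemma lie_anti (R : fieldType) (g : lieAlgType R) (x y : g) :
  lie x y = - lie y x.
Proof.
have lieDl u v w : lie (u + v) w = lie u w + lie v w :> g.
  by have := lie_linearl w 1 u v; rewrite !scale1r.
have := liexx (x + y); rewrite lieDl !linearD /= !liexx add0r addr0.
by move/eqP; rewrite addr_eq0 => /eqP.
Qed.

Lemma lieNl (R : fieldType) (g : lieAlgType R) (x y : g) :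
  lie (- x) y = - lie x y.
Proof. by rewrite lie_anti linearN /= opprK -[RHS]lie_anti. Qed.

Lemma adE (R : fieldType) (g : lieAlgType R) (x y : g) : ad x y = lie x y.
Proof. by rewrite /ad lfunE. Qed.

Lemma lftraceB (R : fieldType) (g : lieAlgType R) (f h : 'End(g)) :
  lftrace (f - h) = lftrace f - lftrace h.
Proof.
rewrite /lftrace addrC -scaleN1r passmx.mxof_linear scaleN1r.
by rewrite linearD linearN addrC.
Qed.

(** The trace can be read off any resolution of the identity. It frees later computations from the
    basis [vbasis] built into [lftrace]. *)
Lemma lftrace_dual (R : fieldType) (g : lieAlgType R) (I : finType)
    (b : I -> g) (c : I -> g -> R) (f : 'End(g)) :
    (forall i, scalar (c i)) -> (forall u, u = \sum_i c i u *: b i) ->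
  lftrace f = \sum_i c i (f (b i)).
Proof.
move=> clin span; pose B := vbasis (fullv : {vspace g}).
pose c' i : {scalar g} :=
  HB.pack (c i) (GRing.isLinear.Build R g R *%R (c i) (clin i)).
have fB i : c i (f (b i)) = \sum_k coord B k (f (b i)) * c i B`_k.
  rewrite {1}(coord_vbasis (memvf (f (b i)))) -[c i _]/(c' i _) linear_sum.
  by apply: eq_bigr => k _; rewrite linearZ.
rewrite (eq_bigr _ (fun i _ => fB i)) exchange_big /=.
apply: eq_bigr => k _; rewrite !mxE /= passmx.vecof_delta.
rewrite {1}(span B`_k) !linear_sum; apply: eq_bigr => i _.
by rewrite !linearZ /= mulrC.
Qed.

(** * Signs in the Chevalley-Eilenberg differential *)

Section CeArgs.
Variables (R : realType) (g : lieAlgType R).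

(** Once x_i is omitted, x_j with j > i sits at position j - 1; moving the bracket there from the
    front costs (-1)^(j-1), which leaves the sign -(-1)^i. *)
Lemma det_ce_args n (phi : g -> 'rV[R[i]]_n) (x : 'I_n.+1 -> g)
    (i j : 'I_n.+1) :
    (i < j)%N ->
  (-1) ^+ (i + j) * \det (\matrix_m phi (ce_args x i j m))
  = - ((-1) ^+ i
       * \det (\matrix_m phi (upd x j (lie (x i) (x j)) (lift i m)))).
Proof.
case: n phi x i j => [|n] phi x i j ij.
  by have := ltn_ord i; have := ltn_ord j; lia.
have /unlift_some[p jp _] : i != j by rewrite -(inj_eq val_inj) ltn_eqF.
have jE : j = p.+1 :> nat by move: ij; rewrite jp /= /bump; lia.
pose B := \matrix_m phi (upd x j (lie (x i) (x j)) (lift i m)).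
rewrite (det_row_to_top (p := p) (B := B)).
- rewrite jE mulrA -exprD -mulNr; congr (_ * _).
  rewrite (_ : (i + p.+1 + p = i.+1 + p * 2)%N); last by lia.
  by rewrite exprD exprM sqrr_sign mulr1 exprS mulN1r.
- by move=> b; rewrite !mxE /ce_args /= -jp upd_at.
move=> m b; rewrite !mxE /ce_args /= upd_off; last first.
  by rewrite jp (inj_eq lift_inj) eq_sym neq_lift.
have /= mn := ltn_ord m; rewrite jE in ij; congr (phi (x _) _ _).
apply: val_inj; rewrite /= add0n jE inordK /bump.
  by move: ij; move: (i : nat) (p : nat) (m : nat) => a c d; lia.
by move: mn; move: (i : nat) (p : nat) (m : nat) => a c d; lia.
Qed.

(** Omitting x_j instead leaves x_i at position i, so moving the bracket there costs (-1)^i. *)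
Lemma det_ce_args_sym n (phi : g -> 'rV[R[i]]_n) (x : 'I_n.+1 -> g)
    (i j : 'I_n.+1) :
    (i < j)%N ->
  (-1) ^+ (i + j) * \det (\matrix_m phi (ce_args x i j m))
  = (-1) ^+ j * \det (\matrix_m phi (upd x i (lie (x i) (x j)) (lift j m))).
Proof.
case: n phi x i j => [|n] phi x i j ij.
  by have := ltn_ord i; have := ltn_ord j; lia.
have /unlift_some[p ip _] : j != i by rewrite -(inj_eq val_inj) gtn_eqF.
have iE : i = p :> nat by move: ij; rewrite ip /= /bump; lia.
pose B := \matrix_m phi (upd x i (lie (x i) (x j)) (lift j m)).
rewrite (det_row_to_top (p := p) (B := B)).
- rewrite iE addnC exprD -mulrA; congr (_ * _).
  by rewrite mulrA -expr2 sqrr_sign mul1r.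
- by move=> b; rewrite !mxE /ce_args /= -ip upd_at.
move=> m b; rewrite !mxE /ce_args /= upd_off; last first.
  by rewrite ip (inj_eq lift_inj) eq_sym neq_lift.
have /= mn := ltn_ord m; rewrite iE in ij; congr (phi (x _) _ _).
apply: val_inj; rewrite /= add0n iE inordK /bump.
  by move: ij; move: (j : nat) (p : nat) (m : nat) => a c d; lia.
by move: mn; move: (j : nat) (p : nat) (m : nat) => a c d; lia.
Qed.

End CeArgs.

(** J makes g a complex vector space with (a + ib)u = au + bJu, and such an F is complex linear on
    it. This is applied to [phi], to [vol] and d vol in one slot, to [phi \o adJ v] and to
    (1,0)-forms. *)
Lemma complex_comb_sum (R : realType) (g : lieAlgType R) (J : 'End(g))
    (W : lmodType R[i]) (F : g -> W) m (c : 'I_m -> R[i]) (u : 'I_m -> g) :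
    (forall a v w, F (a *: v + w) = (a%:C)%C *: F v + F w) ->
    (forall v, F (J v) = 'i%C *: F v) ->
  F (\sum_k (Re (c k) *: u k + Im (c k) *: J (u k))) = \sum_k c k *: F (u k).
Proof.
move=> FP FJ.
have F0 : F 0 = 0.
  by have := FP (-1) 0 0; rewrite scaler0 addr0 rmorphN1 scaleN1r addNr.
elim/big_rec2: _ => [|k y v _ <-]; first exact: F0.
have FZ a w : F (a *: w) = (a%:C)%C *: F w.
  by rewrite -[a *: w]addr0 FP F0 addr0.
rewrite -addrA FP FP FJ scalerA addrA -scalerDl; congr (_ *: _ + _).
by rewrite [RHS]complexE mulrC.
Qed.

(** * The volume form of a complex frame *)

Section Frame.
Variables (R : realType) (g : lieAlgType R) (n : nat) (J : 'End(g)).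
Variables (phi : g -> 'rV[R[i]]_n) (e : 'I_n -> g).
Hypothesis phiP : forall a u v, phi (a *: u + v) = (a%:C)%C *: phi u + phi v.
Hypothesis phiJ : forall u, phi (J u) = 'i%C *: phi u.
Hypothesis phie : forall m, phi (e m) = delta_mx 0 m.
Hypothesis frameP : forall u,
  u = \sum_m (Re (phi u 0 m) *: e m + Im (phi u 0 m) *: J (e m)).
Implicit Types (u v w : g) (x : 'I_n.+1 -> g) (z : 'I_n -> g).

Definition vol z : R[i] := \det (\matrix_m phi (z m)).

Lemma frameD u v : phi (u + v) = phi u + phi v.
Proof. by rewrite -[u]scale1r phiP rmorph1 !scale1r. Qed.

Lemma frameN u : phi (- u) = - phi u.
Proof.
apply/eqP; rewrite -addr_eq0 -frameD addNr -(subrr u) -scaleN1r.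
by rewrite addrC phiP rmorphN1 scaleN1r addNr.
Qed.

Lemma frame_inj : injective phi.
Proof. by move=> u v uv; rewrite (frameP u) (frameP v) uv. Qed.

Lemma eq_vol z1 z2 : z1 =1 z2 -> vol z1 = vol z2.
Proof.
by move=> z12; congr (\det _); apply/matrixP=> a b; rewrite !mxE z12.
Qed.

Lemma vol_frame : vol e = 1.
Proof.
rewrite -[RHS](det1 _ n); congr (\det _).
by apply/matrixP => a b; rewrite !mxE phie mxE eq_sym.
Qed.

Lemma vol_upd_lin z m b c u v w : phi w = b *: phi u + c *: phi v ->
  vol (upd z m w) = b * vol (upd z m u) + c * vol (upd z m v).
Proof.
move=> wuv; apply: (determinant_multilinear (i0 := m)).
- by rewrite !rowK !upd_at.
- by apply/matrixP => a d; rewrite !mxE !upd_lift_neq.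
- by apply/matrixP => a d; rewrite !mxE !upd_lift_neq.
Qed.

Lemma vol_updP z m a u v :
  vol (upd z m (a *: u + v)) = (a%:C)%C * vol (upd z m u) + vol (upd z m v).
Proof.
rewrite (vol_upd_lin _ _ (b := (a%:C)%C) (c := 1) (u := u) (v := v)).
  by rewrite mul1r.
by rewrite scale1r.
Qed.

Lemma vol_updJ z m u : vol (upd z m (J u)) = 'i%C * vol (upd z m u).
Proof.
rewrite (vol_upd_lin _ _ (b := 'i%C) (c := 0) (u := u) (v := u)).
  by rewrite mul0r addr0.
by rewrite scale0r addr0.
Qed.

Lemma vol_updN z m u : vol (upd z m (- u)) = - vol (upd z m u).
Proof.
rewrite (vol_upd_lin _ _ (b := -1) (c := 0) (u := u) (v := u)).
  by rewrite mul0r addr0 mulN1r.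
by rewrite scaleN1r scale0r addr0 frameN.
Qed.

Lemma vol_upd0 z m : vol (upd z m 0) = 0.
Proof.
rewrite (vol_upd_lin _ _ (b := 0) (c := 0) (u := 0) (v := 0)) ?mul0r ?addr0 //.
by apply: (addrI (phi 0)); rewrite -frameD !scale0r !addr0.
Qed.

Lemma vol_alternate z k l : k != l -> z k = z l -> vol z = 0.
Proof.
by move=> kl zkl; apply: (determinant_alternate kl) => j; rewrite !mxE zkl.
Qed.

(* The summand of the Chevalley-Eilenberg differential of vol for the pair     *)
(* {k, l}, with the bracket kept in the slot of x_l and x_k omitted.           *)
Definition ce_term x (k l : 'I_n.+1) : R[i] :=
  - ((-1) ^+ k * vol (fun m => upd x l (lie (x k) (x l)) (lift k m))).

Lemma ce_argsE x (i j : 'I_n.+1) : (i < j)%N ->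
  (-1) ^+ (i + j) * vol (ce_args x i j) = ce_term x i j.
Proof. by move=> ij; rewrite /vol det_ce_args. Qed.

Lemma ce_argsE_sym x (i j : 'I_n.+1) : (i < j)%N ->
  (-1) ^+ (i + j) * vol (ce_args x i j) = ce_term x j i.
Proof.
move=> ij; rewrite /vol det_ce_args_sym // /ce_term (lie_anti (x j)).
have /unlift_some[m im _] : j != i by rewrite -(inj_eq val_inj) gtn_eqF.
pose z a := x (lift j a).
rewrite [in RHS](eq_vol (_ : _ =1 upd z m (- lie (x i) (x j)))) => [|a].
  rewrite vol_updN mulrN opprK; congr (_ * _).
  by apply: eq_vol => a; rewrite im upd_lift.
by rewrite {1}im upd_lift.
Qed.

(** Both sides are the same summand of the differential, with the bracket stored in one slot or the
    other. Hence any chosen slot can be singled out in [dvol], whatever its rank. *)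
Lemma ce_term_sym x k l : ce_term x k l = ce_term x l k.
Proof.
case: (ltngtP k l) => [kl|lk|/val_inj-> //].
  by rewrite -ce_argsE // ce_argsE_sym.
by rewrite -ce_argsE_sym // ce_argsE.
Qed.

(** * The differential of the volume form *)

Definition dvol x : R[i] :=
  \sum_(i < n.+1) \sum_(j < n.+1 | (i < j)%N) ce_term x i j.

Lemma dvol_double x : dvol x *+ 2 = \sum_i \sum_(j | j != i) ce_term x i j.
Proof.
rewrite mulr2n /dvol [X in _ + X](exchange_big_dep predT) //= -big_split.
apply: eq_bigr => i _.
rewrite /= [RHS](bigID (fun j : 'I__ => (i < j)%N)) /=; congr (_ + _).
  by apply: eq_bigl => j; rewrite -(inj_eq val_inj) /=; case: ltngtP.
under [LHS]eq_bigr do rewrite ce_term_sym.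
by apply: eq_bigl => j; rewrite -(inj_eq val_inj) /=; case: ltngtP.
Qed.

Lemma dvol_split x k :
  dvol x = \sum_m ce_term x k (lift k m)
         + \sum_(i < n.+1 | i != k)
             \sum_(j < n.+1 | (i < j)%N && (j != k)) ce_term x i j.
Proof.
rewrite /dvol (bigD1 k) //=.
under [X in _ + X]eq_bigr do rewrite (bigID (fun j : 'I__ => j == k)) /=.
rewrite big_split addrA; congr (_ + _).
rewrite -(sum_neq_lift k (ce_term x k)).
rewrite [RHS](bigID (fun j : 'I__ => (k < j)%N)) /=.
congr (_ + _).
  by apply: eq_bigl => j; rewrite -(inj_eq val_inj) /=; case: ltngtP.
rewrite [RHS]big_mkcond [LHS]big_mkcond /=; apply: eq_bigr => i _.
case: (eqVneq i k) => [_|ik] /=; first by [].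
rewrite (eq_bigl (fun j : 'I_n.+1 => (j == k) && (i < j)%N)) => [|j]; last first.
  exact: andbC.
rewrite big_mkcondr big_pred1_eq ce_term_sym.
by case: ltngtP ik => // /ord_inj->; rewrite eqxx.
Qed.

Lemma eq_dvol x1 x2 : x1 =1 x2 -> dvol x1 = dvol x2.
Proof.
move=> x12; apply: eq_bigr => i _; apply: eq_bigr => j _.
by congr (- (_ * _)); apply: eq_vol => m; rewrite /upd !x12.
Qed.

Lemma ce_term_upd x k m v :
  ce_term (upd x k v) k (lift k m)
  = - ((-1) ^+ k * vol (upd (fun j => x (lift k j)) m (lie v (x (lift k m))))).
Proof.
rewrite /ce_term upd_at upd_lift_neq; congr (- (_ * _)); apply: eq_vol => j.
by rewrite upd_lift /upd; case: eqP => // _; rewrite lift_eqF.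
Qed.

(** Here v stays outside the bracket, so the term inherits from [vol] its complex linearity in v. *)
Lemma ce_term_upd_other x k i j : i != k -> j != k ->
  exists z m, forall v,
    ce_term (upd x k v) i j = - ((-1) ^+ i * vol (upd z m v)).
Proof.
move=> ik jk; case/unlift_some: (ik) => m km _.
exists (fun a => upd x j (lie (x i) (x j)) (lift i a)), m => v.
rewrite /ce_term !(upd_off _ _ (_ : _ != k)) //; congr (- (_ * _)).
apply: eq_vol => a; rewrite -upd_lift -km /upd.
by case: (eqVneq (lift i a) j) => // ->; rewrite (negbTE jk).
Qed.

Lemma ce_term_updP x k i j a u v : i != j ->
  ce_term (upd x k (a *: u + v)) i j
  = (a%:C)%C * ce_term (upd x k u) i j + ce_term (upd x k v) i j.
Proof.
wlog ik : i j / j != k => [Hw ij|ij].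
  case: (eqVneq j k) => [jk|]; last by move=> ?; apply: Hw.
  by rewrite !(ce_term_sym _ i); apply: Hw; rewrite -?jk // eq_sym.
case: (eqVneq i k) => [ik'|ik']; last first.
  by have [z [m E]] := ce_term_upd_other x ik' ik; rewrite !E vol_updP; ring.
rewrite {}ik' in ij *; case/unlift_some: ij ik => m -> _ _.
by rewrite !ce_term_upd lie_linearl vol_updP; ring.
Qed.

Lemma dvol_updP x k a u v :
  dvol (upd x k (a *: u + v)) = (a%:C)%C * dvol (upd x k u) + dvol (upd x k v).
Proof.
rewrite /dvol mulr_sumr -big_split; apply: eq_bigr => i _.
rewrite mulr_sumr -big_split; apply: eq_bigr => j ij.
by rewrite ce_term_updP // -(inj_eq val_inj) ltn_eqF.
Qed.

(* On values of vol, J acts as multiplication by i, so adJ v stands for the    *)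
(* bracket with the (0,1)-vector v + iJv of the complexified Lie algebra.      *)
Definition adJ v : g -> g := fun w => lie v w + J (lie (J v) w).

Definition derivation v z := \sum_m vol (upd z m (adJ v (z m))).

Lemma dvol_updJ x k v :
  dvol (upd x k v) + 'i%C * dvol (upd x k (J v))
  = - ((-1) ^+ k * derivation v (fun m => x (lift k m))).
Proof.
rewrite !(dvol_split _ k) mulrDr addrACA [X in _ + X](_ : _ = 0) ?addr0.
  rewrite !mulr_sumr -big_split -sumrN; apply: eq_bigr => m _ /=.
  rewrite !ce_term_upd /adJ -[lie v _]scale1r vol_updP vol_updJ scale1r rmorph1.
  by ring.
(* Terms whose bracket avoids slot k are complex linear in v, so v + iJv contributes the factor 1 +
   i^2 = 0. *)
rewrite mulr_sumr -big_split big1 // => i ik; rewrite /= mulr_sumr -big_split.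
rewrite big1 // => j /andP[_ jk] /=.
have [z [m E]] := ce_term_upd_other x ik jk; rewrite !E vol_updJ.
have := sqr_i R; set t := 'i%C; move=> t2.
transitivity (- (-1) ^+ i * vol (upd z m v) * (1 + t ^+ 2)); first by ring.
by rewrite t2 subrr mulr0.
Qed.

(** In the sum over ordered pairs, the pair {k, l} gives [x_k, x_k] = 0, the pairs {k, j} and {l, j}
    cancel by [signed_minors_eq_rows], and any other pair leaves two equal arguments in [vol]. *)
Lemma dvol_alternate x k l : k != l -> x k = x l -> dvol x = 0.
Proof.
move=> kl xkl; apply/eqP.
suff: dvol x *+ 2 == 0 by rewrite Num.Theory.mulrn_eq0.
rewrite dvol_double (bigD1 k) //= [X in _ + X](bigD1 l) 1?eq_sym //= addrA.
have Tkl : ce_term x k l = 0.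
  rewrite /ce_term xkl liexx; case/unlift_some: (kl) => m -> _.
  by rewrite (eq_vol (upd_lift _ _ _ _)) vol_upd0 mulr0 oppr0.
have T j : j != k -> j != l -> ce_term x k j = - ce_term x l j.
  move=> jk jl; rewrite /ce_term opprK.
  pose y i := phi (upd x j (lie (x l) (x j)) i).
  have := @signed_minors_eq_rows _ n y k l kl; rewrite /y.
  by rewrite !upd_off 1?eq_sym // xkl => -> //; rewrite opprK.
rewrite [X in _ + X]big1 ?addr0 => [|i /andP[ik il]].
  rewrite (bigD1 l) 1?eq_sym //= Tkl add0r.
  rewrite [X in _ + X](bigD1 k) //= ce_term_sym Tkl add0r.
  rewrite [X in _ + X](eq_bigl (fun j => (j != k) && (j != l))) => [|j]; last first.
    exact: andbC.
  rewrite (eq_bigr (fun j => - ce_term x l j)) => [|j /andP[jk jl]]; last exact: T.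
  by rewrite sumrN addNr.
rewrite (bigD1 k) 1?eq_sym //= (bigD1 l) /=; last by rewrite eq_sym il eq_sym.
rewrite !(ce_term_sym _ i) T // addrA addNr add0r big1 // => j.
case/andP=> /andP[ji jk] jl; rewrite /ce_term.
case/unlift_some: (ik) => mk mkP _; case/unlift_some: (il) => ml mlP _.
rewrite (vol_alternate (k := mk) (l := ml)) ?mulr0 ?oppr0 //.
  by apply: contraNneq kl => mkl; rewrite mkP mlP mkl.
by rewrite -mkP -mlP !upd_off // eq_sym.
Qed.

Lemma frame0 : phi 0 = 0.
Proof. by rewrite -(addNr (0 : g)) frameD frameN addNr. Qed.

Lemma frame_JJ u : J (J u) = - u.
Proof.
apply: frame_inj; rewrite !phiJ frameN scalerA -expr2 sqr_i.
by rewrite scaleN1r.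
Qed.

Lemma vol_updB z m u v :
  vol (upd z m (u - v)) = vol (upd z m u) - vol (upd z m v).
Proof. by rewrite -{1}[u]scale1r vol_updP rmorph1 mul1r vol_updN. Qed.

Lemma vol_upd_frame m w : vol (upd e m w) = phi w 0 m.
Proof.
have := @complex_comb_sum _ _ J R[i]^o (fun v => vol (upd e m v)) n
  (fun k => phi w 0 k) e (vol_updP e m) (vol_updJ e m).
rewrite -frameP => ->; rewrite (bigD1 m) //= big1 => [|k km].
  by rewrite (eq_vol (upd_id e m)) vol_frame addr0 [LHS]mulr1.
rewrite (vol_alternate km) ?scaler0 //.
by rewrite upd_at upd_off.
Qed.

Lemma dvol_Jlinear_eq0 x :
    (forall k v, dvol (upd x k v) + 'i%C * dvol (upd x k (J v)) = 0) ->
  dvol x = 0.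
Proof.
move=> dJ; have [c [[l cl] c0]] := lin_dep_rows (fun k => phi (x k)).
have dvolJ v : dvol (upd x l (J v)) = 'i%C * dvol (upd x l v).
  have /eqP := dJ l v; rewrite addr_eq0 => /eqP ->.
  by rewrite mulrN mulrA -expr2 sqr_i mulN1r opprK.
pose w := \sum_k (Re (c k) *: x k + Im (c k) *: J (x k)).
(* Inserting [w] in slot [l] gives zero, while alternation leaves only [c l * dvol x] of the
   expansion. *)
have w0 : w = 0.
  by apply: frame_inj; rewrite frame0 (complex_comb_sum c x phiP phiJ).
have := @complex_comb_sum _ _ J R[i]^o (fun v => dvol (upd x l v)) _
  c x (dvol_updP x l) dvolJ.
rewrite -/w w0 (bigD1 l) //= big1 => [|k kl].
  rewrite addr0 (eq_dvol (upd_id x l)).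
  have := dvol_updP x l (-1) 0 0; rewrite scaler0 addr0 rmorphN1 mulN1r addNr.
  by move=> -> /eqP; rewrite eq_sym mulf_eq0 (negbTE cl) => /eqP.
by rewrite (dvol_alternate kl) ?scaler0 // upd_at upd_off.
Qed.

(** * Integrability and the complex trace of [adJ v] *)

Lemma adJ_lin v a u w : adJ v (a *: u + w) = a *: adJ v u + adJ v w.
Proof. by rewrite /adJ !linearP /= scalerDr addrACA. Qed.

Lemma J_nijenhuis v u : J (nijenhuis J v u) = J (adJ v u) - adJ v (J u).
Proof.
by rewrite /nijenhuis /adJ !(linearD, linearN) /= !frame_JJ !addrA.
Qed.

Lemma integrableP :
  integrable J <-> forall v u, adJ v (J u) = J (adJ v u).
Proof.
split=> [NJ v u|AJ v u].
  by apply/eqP; rewrite eq_sym -subr_eq0 -J_nijenhuis NJ linear0.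
apply: oppr_inj; rewrite -frame_JJ J_nijenhuis AJ subrr linear0.
by rewrite oppr0.
Qed.

(** In the summands that differentiate another slot, J simply comes out as i; the summand of slot m
    comes out only up to the commutator of [adJ v] and J. *)
Lemma derivation_updJ v z m u :
  derivation v (upd z m (J u)) = 'i%C * derivation v (upd z m u)
    + vol (upd z m (adJ v (J u) - J (adJ v u))).
Proof.
have updupd w w' : upd (upd z m w) m w' =1 upd z m w'.
  by move=> a; rewrite /upd; case: eqP.
rewrite /derivation (bigD1 m) //= [X in _ = _ * X + _](bigD1 m) //=.
rewrite mulrDr addrAC.
rewrite !(eq_vol (updupd _ _)) !upd_at -vol_updJ vol_updB.
rewrite addrC (addrC (vol _)) subrK.
rewrite mulr_sumr addrC; congr (_ + _); apply: eq_bigr => k km.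
rewrite !(upd_off _ _ km).
have updC w :
    upd (upd z m w) k (adJ v (z k)) =1 upd (upd z k (adJ v (z k))) m w.
  by move=> a; rewrite /upd; case: (eqVneq a k) => // ->; rewrite (negbTE km).
by rewrite !(eq_vol (updC _)) vol_updJ.
Qed.

Definition ctrace v : R[i] := \sum_m phi (adJ v (e m)) 0 m.

Lemma derivation_trace v z : (forall u, adJ v (J u) = J (adJ v u)) ->
  derivation v z = ctrace v * vol z.
Proof.
move=> AJ; pose B := \matrix_m phi (adJ v (e m)).
have BE u : phi (adJ v u) = phi u *m B.
  rewrite {1}(frameP u) -[LHS]/((phi \o adJ v) _) complex_comb_sum /=.
  - by rewrite mulmx_sum_row; apply: eq_bigr => m _; rewrite rowK.
  - by move=> a w1 w2; rewrite adJ_lin phiP.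
  - by move=> w; rewrite AJ phiJ.
transitivity (\tr B * vol z); last first.
  by congr (_ * _); apply: eq_bigr => m _; rewrite mxE.
rewrite -sum_det_upd_row; apply: eq_bigr => m _; congr (\det _).
apply/row_matrixP => k; rewrite !rowK /upd.
case: eqP => _; last by rewrite rowK.
by rewrite row_mul rowK BE.
Qed.

(** * Real traces and the Koszul form *)

Lemma lftrace_Jlinear (f : 'End(g)) : (forall u, f (J u) = J (f u)) ->
  lftrace f = Re (\sum_m phi (f (e m)) 0 m) *+ 2.
Proof.
(* In the real basis e_m, Je_m with dual forms Re phi_m, Im phi_m, the two halves contribute equally
   because Im(ip) = Re p. *)
move=> fJ.
pose b (i : 'I_n + 'I_n) := match i with inl m => e m | inr m => J (e m) end.
pose c (i : 'I_n + 'I_n) u :=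
  match i with inl m => Re (phi u 0 m) | inr m => Im (phi u 0 m) end.
rewrite (lftrace_dual (b := b) (c := c)); last 2 first.
- by case=> m a u v /=; rewrite phiP !mxE;
    case: (phi u 0 m) (phi v 0 m) => [? ?] [? ?] /=; rewrite mul0r ?subr0 ?addr0.
- by move=> u; rewrite big_sumType /= {1}(frameP u) big_split.
have ReD : {morph @Re R : p q / p + q} by case=> ? ? [].
rewrite big_sumType /= mulr2n (big_morph (@Re R) ReD (erefl : Re 0 = 0)).
by congr (_ + _); apply: eq_bigr => m _; rewrite fJ phiJ mxE mulrC ImiRe.
Qed.

Definition adJ_lfun v : 'End(g) := (ad v + (J \o ad (J v)))%VF.

Lemma adJ_lfunE v u : adJ_lfun v u = adJ v u.
Proof. by rewrite /adJ_lfun add_lfunE comp_lfunE !adE. Qed.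

(** Since J^2 = -1, psi(v) is the real trace of J after [adJ v], and psi(Jv) that of [adJ v]
    itself. *)
Lemma koszul_ctrace v : (forall u, adJ v (J u) = J (adJ v u)) ->
  koszul J v = - Im (ctrace v) *+ 2 /\ koszul J (J v) = Re (ctrace v) *+ 2.
Proof.
move=> AJ; rewrite /koszul -!lftraceB; split.
  have -> : (J \o ad v - ad (J v) = J \o adJ_lfun v)%VF.
    apply/lfunP => u; rewrite add_lfunE opp_lfunE !comp_lfunE adJ_lfunE !adE /adJ.
    by rewrite linearD /= frame_JJ.
  rewrite lftrace_Jlinear => [|u]; last by rewrite !comp_lfunE !adJ_lfunE AJ.
  congr (_ *+ 2); rewrite -ReiNIm mulr_suml.
  by congr Re; apply: eq_bigr => m _; rewrite comp_lfunE adJ_lfunE phiJ mxE mulrC.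
have -> : (J \o ad (J v) - ad (J (J v)) = adJ_lfun v)%VF.
  apply/lfunP => u; rewrite add_lfunE opp_lfunE adJ_lfunE comp_lfunE !adE.
  rewrite frame_JJ /adJ /=.
  by rewrite lieNl opprK addrC.
rewrite lftrace_Jlinear => [|u]; last by rewrite !adJ_lfunE AJ.
by congr (Re _ *+ 2); apply: eq_bigr => m _; rewrite adJ_lfunE.
Qed.

Lemma dvol_eq0P :
  (forall x, dvol x = 0) <-> integrable J /\ forall v, koszul J v = 0.
Proof.
rewrite integrableP; split=> [d0|[AJ K0] x].
  have D0 v z : derivation v z = 0.
    pose x i := if unlift 0 i is Some m then z m else v.
    have := dvol_updJ x 0 v; rewrite !d0 mulr0 addr0 expr0 mul1r => /eqP.
    rewrite eq_sym oppr_eq0 => /eqP D0; rewrite -[RHS]D0; apply: eq_bigr => m _.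
    by rewrite /x liftK; apply: eq_vol => a; rewrite /upd liftK.
  (* Evaluating [derivation_updJ] on the frame reads off each coordinate of the commutator through
     [vol_upd_frame]. *)
  have AJ v u : adJ v (J u) = J (adJ v u).
    apply/eqP; rewrite -subr_eq0; apply/eqP/frame_inj/rowP => m.
    rewrite frame0 mxE -vol_upd_frame.
    have := derivation_updJ v e m u; rewrite !D0 mulr0 add0r.
    by move->.
  split=> // v.
  have [-> _] := koszul_ctrace (AJ v).
  have := D0 v e; rewrite derivation_trace // vol_frame mulr1 => ->.
  by rewrite oppr0 mul0rn.
apply: dvol_Jlinear_eq0 => k v; rewrite dvol_updJ.
rewrite [X in _ * X](derivation_trace _ (AJ v)).
have [] := koszul_ctrace (AJ v); rewrite !K0.
case: (ctrace v) => a b /= /eqP; rewrite eq_sym Num.Theory.mulrn_eq0 oppr_eq0.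
move=> /eqP -> /eqP; rewrite eq_sym Num.Theory.mulrn_eq0 => /eqP ->.
by rewrite mul0r mulr0 oppr0.
Qed.

End Frame.

(** * Existence of a frame and reduction of sigma to [vol] *)

Lemma Rcomplex_linearP (R : realType) (V : lmodType R)
    (f : {linear V -> Rcomplex R}) a u v :
  (f (a *: u + v) : R[i]) = (a%:C)%C * f u + f v.
Proof.
rewrite linearP; case: (f u) (f v) => [p q] [s t].
by apply/eqP; rewrite eq_complex /= !mul0r subr0 addr0 !eqxx.
Qed.

Lemma exists_frame (R : realType) (g : lieAlgType R) n (J : 'End(g))
    (gamma : 'I_n -> {linear g -> Rcomplex R}) (x0 : 'I_n -> g) :
    \dim (fullv : {vspace g}) = (2 * n)%N ->
    (forall i, is_form10 J (gamma i)) -> wedge gamma x0 != 0 ->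
  exists phi : g -> 'rV[R[i]]_n,
  [/\ forall a u v, phi (a *: u + v) = (a%:C)%C *: phi u + phi v,
      forall u, phi (J u) = 'i%C *: phi u,
      forall m, phi (x0 m) = delta_mx 0 m &
      forall u,
        u = \sum_m (Re (phi u 0 m) *: x0 m + Im (phi u 0 m) *: J (x0 m))].
Proof.
move=> dimg gammaJ wedge0.
pose G : 'M[R[i]]_n := \matrix_(m, i) (gamma i (x0 m) : R[i]).
have Gunit : G \in unitmx.
  rewrite unitmxE unitfE -det_tr; move: wedge0; rewrite /wedge.
  by congr (\det _ != 0); apply/matrixP => i j; rewrite !mxE.
(* Dividing by the values of the forms at [x0] makes the coordinates dual to [x0]. *)
pose phi u := (\row_i (gamma i u : R[i])) *m invmx G.
have phiP a u v : phi (a *: u + v) = (a%:C)%C *: phi u + phi v.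
  rewrite /phi scalemxAl -mulmxDl; congr (_ *m _); apply/rowP => i.
  by rewrite !mxE Rcomplex_linearP.
have phiJ u : phi (J u) = 'i%C *: phi u.
  rewrite /phi scalemxAl; congr (_ *m _); apply/rowP => i.
  by rewrite !mxE gammaJ.
have phie m : phi (x0 m) = delta_mx 0 m.
  rewrite /phi -(_ : row m G = \row_i gamma i (x0 m)); last first.
    by apply/rowP => i; rewrite !mxE.
  by rewrite -row_mul mulmxV // rowE mulmx1.
exists phi; split => //; clearbody phi.
pose f0 u : 'rV[R]_(n + n) :=
  row_mx (\row_m Re (phi u 0 m)) (\row_m Im (phi u 0 m)).
have f0_lin : linear f0.
  move=> a u v; rewrite /f0 scale_row_mx add_row_mx.
  by congr row_mx; apply/rowP => m; rewrite !mxE phiP !mxE;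
    case: (phi u 0 m) (phi v 0 m) => [? ?] [? ?] /=; rewrite mul0r ?subr0 ?addr0.
pose f : 'Hom(g, 'rV[R]_(n + n)) :=
  linfun (HB.pack_for {linear g -> 'rV[R]_(n + n)} f0
            (GRing.isLinear.Build R g _ *:%R f0 f0_lin)).
have fE u : f u = f0 u by rewrite /f lfunE.
have comb (c : 'I_n -> R[i]) :
  phi (\sum_m (Re (c m) *: x0 m + Im (c m) *: J (x0 m))) = \row_m c m.
  rewrite complex_comb_sum //; apply/rowP => m.
  rewrite summxE (bigD1 m) //= big1 => [|k km].
    by rewrite phie !mxE !eqxx mulr1 addr0.
  by rewrite phie !mxE eq_sym (negbTE km) andbF mulr0.
(* The real and imaginary coordinates map g onto a space of the same dimension 2n, so they determine
   a vector. *)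
have f_onto : limg f = fullv.
  apply/eqP; rewrite eqEsubv subvf; apply/subvP => w _.
  pose c m := Complex (lsubmx w 0 m) (rsubmx w 0 m).
  have -> : w = f (\sum_m (Re (c m) *: x0 m + Im (c m) *: J (x0 m))).
    rewrite fE /f0 comb -{1}[w]hsubmxK.
    by congr row_mx; apply/rowP => m; rewrite [RHS]mxE [in RHS]mxE.
  by rewrite memv_img ?memvf.
have f_inj : lker f == 0%VS.
  have dimW : \dim {:'rV[R]_(n + n)} = (2 * n)%N.
    by rewrite dimvf /dim /= mul1n addnn mul2n.
  have /eqP := limg_ker_dim f fullv; rewrite f_onto capfv dimg dimW.
  by rewrite -[X in _ == X]add0n eqn_add2r dimv_eq0.
move=> u; apply: (lker0P f_inj); rewrite !fE /f0 comb.
by congr row_mx; apply/rowP => m; rewrite !mxE.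
Qed.

(** By complex linearity the matrix of gamma_i(z_j) is the matrix of gamma_i(e_l) times that of the
    coordinates of z, so each wedge product is a multiple of [vol]. *)
Lemma formn0_vol (R : realType) (g : lieAlgType R) n (J : 'End(g))
    (sigma : cform g n) (phi : g -> 'rV[R[i]]_n) (e : 'I_n -> g) :
    is_formn0 J sigma ->
    (forall m, phi (e m) = delta_mx 0 m) ->
    (forall u,
       u = \sum_m (Re (phi u 0 m) *: e m + Im (phi u 0 m) *: J (e m))) ->
  forall z, sigma z = sigma e * vol phi z.
Proof.
case=> [m [c [gamma [gammaJ sigmaE]]]] phie frameP z.
rewrite !sigmaE mulr_suml; apply: eq_bigr => k _; rewrite -mulrA; congr (_ * _).
rewrite /wedge /vol -[in X in _ * X]det_tr -det_mulmx; congr (\det _).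
apply/matrixP => i j; rewrite !mxE {1}(frameP (z j)).
have := @complex_comb_sum _ _ J R[i]^o (gamma k i) _ (phi (z j) 0) e.
move=> -> //; last exact: gammaJ.
  by apply: eq_bigr => l _; rewrite !mxE mulrC.
exact: Rcomplex_linearP.
Qed.

Theorem theorem3p2 (R : realType) (g : lieAlgType R) (n : nat)
    (hdim : \dim (fullv : {vspace g}) = (2 * n)%N)
    (J : 'End(g)) (hJ : almost_complex J)
    (sigma : cform g n) (hsigma : is_formn0 J sigma)
    (hsigma0 : exists x, sigma x <> 0) :
  (forall x, ce_d sigma x = 0) <->
  (integrable J /\ forall x, koszul J x = 0).
Proof.
have [x0 sigma0] := hsigma0; have [m [c [gamma [gammaJ sigmaE]]]] := hsigma.
(* A nonzero sum has a nonzero summand; its (1,0)-forms supply the coordinates. *)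
have [k wk] : exists k, wedge (gamma k) x0 != 0.
  apply/existsP; apply: contra_notT sigma0; rewrite negb_exists => /forallP w0.
  by rewrite sigmaE big1 // => k _; have /negPn/eqP-> := w0 k; rewrite mulr0.
have [phi [phiP phiJ phie frameP]] := exists_frame hdim (gammaJ k) wk.
have sigma_vol := formn0_vol hsigma phie frameP.
rewrite -(dvol_eq0P phiP phiJ phie frameP).
have dE x : ce_d sigma x = sigma x0 * dvol phi x.
  rewrite mulr_sumr; apply: eq_bigr => i _; rewrite mulr_sumr.
  by apply: eq_bigr => j ij; rewrite sigma_vol mulrCA ce_argsE.
split=> d0 x; last by rewrite dE d0 mulr0.
by have /eqP := d0 x; rewrite dE mulf_eq0 => /orP[/eqP|/eqP].
Qed.
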